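(* Let $\varphi:(0,\infty)\to(0,\infty)$ be a concave function. If $Q$ is a convex polytope in $\mathbb{R}^3$ (with nonempty interior), then $$M_\varphi(Q)\le \frac12\,\varphi\left(\overline{\theta_Q}\right)\Lambda_Q,$$ with equality if and only if $\varphi$ is affine or all of the dihedral angles of $Q$ are equal. If $\varphi$ is replaced by a convex function $\psi:(0,\infty)\to(0,\infty)$, then the reverse inequality holds with the same equality conditions.
   Context: For a convex polytope $Q$ in $\mathbb{R}^3$, $\mathcal{F}_1(Q)$ is the set of edges of $Q$ and $\operatorname{vol}_1(E)$ is the length of an edge $E$. The external angle $\theta_E$ of $Q$ at the edge $E$ is the angle between the outer unit normals of the two facets of $Q$ that meet at $E$. The total edge length is $\Lambda_Q:=\sum_{E\in\mathcal{F}_1(Q)}\operatorname{vol}_1(E)$, and $$\overline{\theta_Q}:=\sum_{E\in\mathcal{F}_1(Q)}\frac{\operatorname{vol}_1(E)}{\Lambda_Q}\,\theta_E.$$ For a convex or concave function $g:(0,\infty)\to(0,\infty)$, the $g$-weighted edge curvature functional is $$M_g(Q):=\frac12\sum_{E\in\mathcal{F}_1(Q)}\operatorname{vol}_1(E)\,g(\theta_E).$$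
   Formalization: In the equality condition, ''affine'' is taken to mean affine on the smallest interval containing the external angles of Q; with affine on all of (0,∞) the ''only if'' fails, e.g. for min(t,π) and a prism over an equilateral triangle. *)

(* Defs.v *)
From mathcomp Require Import all_boot all_order all_algebra.
From mathcomp Require Import all_classical all_reals all_analysis.

Set Implicit Arguments.
Unset Strict Implicit.
Unset Printing Implicit Defensive.

Import Order.TTheory GRing.Theory Num.Theory.
Import numFieldNormedType.Exports.

Local Open Scope classical_set_scope.
Local Open Scope ring_scope.

Section Euclidean.
Variables (R : realType) (n : nat).
Implicit Types u v : 'rV[R]_n.

Definition dot u v : R := \sum_(i < n) u 0 i * v 0 i.

(* The library norm [`|u|] on ['rV[R]_n] is the sup norm, hence a separate
   Euclidean norm; both induce the same topology. *)
Definition enorm u : R := Num.sqrt (dot u u).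

Definition angle u v : R := acos (dot u v / (enorm u * enorm v)).

Definition segment u v : set 'rV[R]_n :=
  [set x | exists2 t : R, 0 <= t <= 1 & x = (1 - t) *: u + t *: v].

Definition conv_hull (A : set 'rV[R]_n) : set 'rV[R]_n :=
  smallest (@convex_set R 'rV[R]_n) A.

Definition convex_polytope (Q : set 'rV[R]_n) : Prop :=
  exists s : seq 'rV[R]_n, Q = conv_hull [set` s].

(* [U] is the direction space of the affine hull of [A]. *)
Definition has_dim (k : nat) (A : set 'rV[R]_n) : Prop :=
  exists x0 : 'rV[R]_n, exists U : {vspace 'rV[R]_n},
    [/\ A x0,
        forall x, A x -> x - x0 \in U,
        forall W : {vspace 'rV[R]_n},
          (forall x, A x -> x - x0 \in W) -> (U <= W)%VS
      & \dim U = k].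

(* The intersection of [Q] with its supporting hyperplane of outer normal [u]. *)
Definition support_set (Q : set 'rV[R]_n) u : set 'rV[R]_n :=
  [set x | Q x /\ forall y, Q y -> dot u y <= dot u x].

(* The [k]-dimensional proper faces of [Q]. *)
Definition faces (k : nat) (Q : set 'rV[R]_n) : set (set 'rV[R]_n) :=
  [set F | has_dim k F /\ exists2 u, u != 0 & F = support_set Q u].

Definition outer_unit_normal (Q F : set 'rV[R]_n) u : Prop :=
  enorm u = 1 /\ F = support_set Q u.

(* [xget] selects the unique element of the set; [E] is meant to be a segment. *)
Definition vol1 (E : set 'rV[R]_n) : R :=
  xget 0 [set l | exists u v, E = segment u v /\ l = enorm (v - u)].

End Euclidean.

Section Polytope3.
Variable R : realType.
Implicit Types (Q E : set 'rV[R]_3) (g : R -> R).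

Definition edges Q := faces 1 Q.
Definition facets Q := faces 2 Q.

(* The two facets meeting at the edge [E] are those whose intersection is [E];
   for an edge of a polytope with nonempty interior they exist and are unique,
   and the default value 0 of [xget] is not used. *)
Definition external_angle Q E : R :=
  xget 0 [set t | exists F G u v,
    [/\ facets Q F /\ facets Q G, F `&` G = E,
        outer_unit_normal Q F u, outer_unit_normal Q G v
      & t = angle u v]].

Definition dihedral_angle Q E : R := pi - external_angle Q E.

Definition total_edge_length Q : R := \sum_(E \in edges Q) vol1 E.

Definition mean_external_angle Q : R :=
  \sum_(E \in edges Q) vol1 E / total_edge_length Q * external_angle Q E.

Definition edge_curvature g Q : R :=
  2^-1 * \sum_(E \in edges Q) vol1 E * g (external_angle Q E).

(* The smallest interval containing all the external angles of [Q]. *)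
Definition external_angle_range Q : set R :=
  [set t | exists E F, [/\ edges Q E, edges Q F
                         & external_angle Q E <= t <= external_angle Q F]].

Definition all_dihedral_angles_equal Q : Prop :=
  forall E F, edges Q E -> edges Q F -> dihedral_angle Q E = dihedral_angle Q F.

End Polytope3.

(* Functions [(0, +oo) -> (0, +oo)] are represented by functions [R -> R] whose
   values outside of [(0, +oo)] are irrelevant. *)
Section RealFunctions.
Variable R : realType.
Implicit Types f : R -> R.

Definition positive_on_pos f : Prop := forall t, 0 < t -> 0 < f t.

Definition convex_on_pos f : Prop :=
  convex_function (`]0, +oo[%classic : set R^o) f.

Definition concave_on_pos f : Prop :=
  convex_function (`]0, +oo[%classic : set R^o) (fun t => - f t).

Definition affine_on (D : set R) f : Prop :=
  exists a b : R, forall t, D t -> f t = a * t + b.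

End RealFunctions.

(* Main.v *)
Require Import Defs.
From mathcomp Require Import all_boot all_order all_algebra.
From mathcomp Require Import all_classical all_reals all_analysis.
From mathcomp Require Import ring lra.
Import Order.TTheory GRing.Theory Num.Theory.
Import numFieldNormedType.Exports.
Local Open Scope classical_set_scope.
Local Open Scope ring_scope.

Set Implicit Arguments.
Unset Strict Implicit.
Unset Printing Implicit Defensive.

(** The inequality is Jensen's inequality for the external angles [theta_E]
    with the weights [vol1 E / total_edge_length Q].  At the mean angle [m], a
    convex function on the open half-line has a supporting line
    ([supporting_line]); averaging the supporting inequality over the edges
    gives the bound ([jensen]).
    Equality forces the function to meet its supporting line at every external
    angle.  By convexity it then lies below that line on the whole interval
    spanned by the external angles, hence coincides with it there.  Conversely,
    an affine function commutes with weighted means, and equal dihedral angles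
    reduce that interval to a point, on which every function is affine.  The
    concave case is the convex one applied to the opposite function.

    For this argument the sums over edges must be honest finite sums with
    positive weights, taken at positive angles, and this is where the geometry
    of [Q] enters.

    - There are finitely many edges: a face of the convex hull of a finite set
      is the convex hull of the generating points that it contains
      ([support_set_conv_hull]).

    - Each edge has positive length: it is the hull of finitely many collinear
      points, hence a segment, and it is not a single point ([vol1_gt0]).

    - Each external angle is positive ([external_angle_gt0]).  The two normals
      defining it differ, since otherwise the two facets would coincide with
      their intersection, which has dimension one.  That an edge is the
      intersection of two facets ([edge_facets]) is seen by rotating a
      supporting plane of the edge about the line of the edge, in both
      directions, until it hits a vertex of [Q] off the edge ([rotate_to_facet]). *)

(** * Jensen's inequality on the open half-line, with its equality case *)

Section Jensen.
Variable R : realType.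
Implicit Types (f : R -> R) (t x y : R).

Lemma convex_on_posE f t x y : convex_on_pos f -> 0 <= t <= 1 ->
  0 < x -> 0 < y -> f (t * x + (1 - t) * y) <= t * f x + (1 - t) * f y.
Proof.
move=> cvx /andP[t0 t1] x0 y0; have := cvx (Itv01 t0 t1) x y.
by apply; rewrite inE /= in_itv /= andbT.
Qed.

Lemma chord_above f a b x y t : convex_on_pos f -> 0 < x -> x <= t <= y ->
  f x = a * x + b -> f y = a * y + b -> f t <= a * t + b.
Proof.
move=> cvx x0 /andP[xt ty] fx fy.
have [xy|xy] := eqVneq x y.
  have -> : t = x by apply: le_anti; rewrite xt xy ty.
  by rewrite fx.
have yx : 0 < y - x by rewrite subr_gt0 lt_neqAle xy (le_trans xt ty).
pose s := (y - t) / (y - x).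
have tE : t = s * x + (1 - s) * y by rewrite /s; field; rewrite gt_eqF.
have s01 : 0 <= s <= 1.
  rewrite /s divr_ge0 ?(ltW yx) ?subr_ge0 //= ler_pdivrMr // mul1r.
  by rewrite lerD2l lerN2.
have y0 : 0 < y by rewrite (lt_le_trans x0) // (le_trans xt).
have := convex_on_posE cvx s01 x0 y0; rewrite -tE fx fy => /le_trans; apply.
by rewrite [in leRHS]tE le_eqVlt; apply/orP; left; apply/eqP; ring.
Qed.

(** The three-chord inequality. *)
Lemma slopes_le f x m y : convex_on_pos f -> 0 < x -> x < m -> m < y ->
  (f m - f x) / (m - x) <= (f y - f m) / (y - m).
Proof.
move=> cvx x0 xm my; have y0 : 0 < y by lra.
pose s := (y - m) / (y - x).
have yx : 0 < y - x by lra.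
have ym : 0 < y - m by lra.
have mx : 0 < m - x by lra.
have s01 : 0 <= s <= 1.
  by rewrite /s divr_ge0 ?(ltW yx, ltW ym) //= ler_pdivrMr // mul1r; lra.
have mE : m = s * x + (1 - s) * y by rewrite /s; field; rewrite gt_eqF.
have := convex_on_posE cvx s01 x0 y0; rewrite -mE => fm.
rewrite ler_pdivrMr // mulrAC ler_pdivlMr //.
have : f m * (y - x) <= (s * f x + (1 - s) * f y) * (y - x).
  by rewrite ler_wpM2r // ltW.
have -> : (s * f x + (1 - s) * f y) * (y - x)
          = (y - m) * f x + (m - x) * f y.
  by rewrite /s; field; rewrite gt_eqF.
lra.
Qed.

(** The slope is the supremum of the slopes of the chords that end at [m], which
    the three-chord inequality bounds by the slopes of those that start there. *)
Lemma supporting_line f m : convex_on_pos f -> 0 < m ->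
  exists a, forall t, 0 < t -> f m + a * (t - m) <= f t.
Proof.
move=> cvx m0.
pose S := [set (f m - f x) / (m - x) | x in [set x | 0 < x < m]].
have ubS y : m < y -> ubound S ((f y - f m) / (y - m)).
  by move=> my _ [x /andP[x0 xm] <-]; exact: slopes_le.
have hm : 0 < m / 2 < m by apply/andP; split; lra.
have S0 : S !=set0 by exists ((f m - f (m / 2)) / (m - m / 2)), (m / 2).
exists (sup S) => t t0; case: (ltgtP t m) => [tm|mt|->].
- have : (f m - f t) / (m - t) <= sup S.
    apply: ub_le_sup; last by exists t => //; apply/andP.
    by exists ((f (m + 1) - f m) / (m + 1 - m)); apply: ubS; lra.
  rewrite ler_pdivrMr ?subr_gt0 //; lra.
- have : sup S <= (f t - f m) / (t - m) by apply: ge_sup => //; exact: ubS.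
  rewrite ler_pdivlMr ?subr_gt0 //; lra.
- by rewrite subrr mulr0 addr0.
Qed.

Variables (I : eqType) (s : seq I) (w x : I -> R).
Hypothesis w_gt0 : forall i, i \in s -> 0 < w i.
Hypothesis x_gt0 : forall i, i \in s -> 0 < x i.
Hypothesis s_neq0 : s != [::].

Let W := \sum_(i <- s) w i.
Let m := \sum_(i <- s) w i / W * x i.

Lemma weight_gt0 : 0 < W.
Proof.
rewrite /W; case: s s_neq0 w_gt0 => // i r _ wp.
rewrite big_cons ltr_pwDl ?wp ?mem_head // big_seq sumr_ge0 // => j jr.
by rewrite ltW // wp // inE jr orbT.
Qed.

Lemma meanM : m * W = \sum_(i <- s) w i * x i.
Proof.
rewrite mulr_suml; apply: eq_bigr => i _; field.
by rewrite gt_eqF // weight_gt0.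
Qed.

Lemma sum_affine a b :
  \sum_(i <- s) w i * (a * x i + b) = (a * m + b) * W.
Proof.
rewrite mulrDl -mulrA meanM !mulr_sumr -big_split /=.
by apply: eq_bigr => i _; ring.
Qed.

Lemma mean_gt0 : 0 < m.
Proof.
rewrite -(pmulr_lgt0 _ weight_gt0) meanM.
case: s s_neq0 w_gt0 x_gt0 => // i r _ wp xp.
rewrite big_cons ltr_pwDl ?mulr_gt0 ?wp ?xp ?mem_head //.
rewrite big_seq sumr_ge0 // => j jr.
by rewrite ltW // mulr_gt0 ?wp ?xp // inE jr orbT.
Qed.

(** If all values were on the same strict side of the mean, so would be their
    mean. *)
Lemma mean_between :
  exists i j, [/\ i \in s, j \in s & x i <= m <= x j].
Proof.
have W0 := weight_gt0.
have [i is_ im] : exists2 i, i \in s & x i <= m.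
  apply/hasP; apply: contraT; rewrite -all_predC => /allP gtm.
  suff : m * W < m * W by rewrite ltxx.
  rewrite {2}meanM mulr_sumr big_seq [ltRHS]big_seq.
  apply: ltr_sum => [|i si].
    by case: s s_neq0 => // i r _; apply/hasP; exists i; rewrite ?mem_head.
  rewrite mulrC ltr_pM2l ?w_gt0 //.
  by have := gtm i si; rewrite /= -ltNge.
have [j js jm] : exists2 j, j \in s & m <= x j.
  apply/hasP; apply: contraT; rewrite -all_predC => /allP ltm.
  suff : m * W < m * W by rewrite ltxx.
  rewrite {1}meanM mulr_sumr big_seq [ltRHS]big_seq.
  apply: ltr_sum => [|j sj].
    by case: s s_neq0 => // j r _; apply/hasP; exists j; rewrite ?mem_head.
  rewrite [m * _]mulrC ltr_pM2l ?w_gt0 //.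
  by have := ltm j sj; rewrite /= -ltNge.
by exists i, j; rewrite im jm.
Qed.

Let D : set R := [set t | exists i j, [/\ i \in s, j \in s & x i <= t <= x j]].

(** The supporting line at [m] has mean value [f m], so the difference of the
    two sides is a sum of nonnegative gaps between [f] and this line.  When it
    vanishes, [f] meets the line at both ends of any chord between data points,
    and [f] is squeezed between the line and the chord. *)
Lemma jensen f : convex_on_pos f ->
  f m * W <= \sum_(i <- s) w i * f (x i) /\
  (\sum_(i <- s) w i * f (x i) = f m * W <-> affine_on D f).
Proof.
move=> cvx; have [a fa] := supporting_line cvx mean_gt0.
pose b := f m - a * m.
have fge t : 0 < t -> a * t + b <= f t.
  by move=> /fa; apply: le_trans; rewrite /b; lra.
have lineE : \sum_(i <- s) w i * (a * x i + b) = f m * W.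
  by rewrite sum_affine /b addrC subrK.
split.
  rewrite -lineE big_seq [leRHS]big_seq; apply: ler_sum => i si.
  by rewrite ler_wpM2l ?fge ?x_gt0 // ltW // w_gt0.
split=> [eqf|[c [d fcd]]].
  have touch i : i \in s -> f (x i) = a * x i + b.
    move=> si; apply/eqP.
    have gap j : j \in s -> 0 <= w j * (f (x j) - (a * x j + b)).
      by move=> sj; rewrite mulr_ge0 ?subr_ge0 ?fge ?x_gt0 // ltW // w_gt0.
    have : \sum_(j <- s | j \in s) w j * (f (x j) - (a * x j + b)) == 0.
      rewrite -big_seq; under eq_bigr do rewrite mulrBr.
      by rewrite sumrB eqf lineE subrr.
    rewrite psumr_eq0 // => /allP /(_ i si); rewrite si /=.
    by rewrite mulf_eq0 gt_eqF ?w_gt0 //= subr_eq0.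
  exists a, b => t [i [j [si sj tij]]].
  have x0 := x_gt0 si; have t0 : 0 < t by case/andP: tij => + _; lra.
  apply: le_anti; rewrite fge // andbT.
  exact: (chord_above cvx x0 tij (touch i si) (touch j sj)).
rewrite (fcd _ mean_between) -sum_affine big_seq [RHS]big_seq.
by apply: eq_bigr => i si; rewrite fcd //; exists i, i; rewrite lexx.
Qed.

End Jensen.

(** * Scalar product, convex hulls and their supporting sets *)

Section Dot.
Variables (R : realType) (n : nat).
Implicit Types (u v x y : 'rV[R]_n) (a : R).

Lemma dotC u v : dot u v = dot v u.
Proof. by apply: eq_bigr => i _; rewrite mulrC. Qed.

Lemma dotDr u v x : dot u (v + x) = dot u v + dot u x.
Proof. by rewrite /dot -big_split; apply: eq_bigr => i _; rewrite mxE mulrDr. Qed.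

Lemma dotZr u a v : dot u (a *: v) = a * dot u v.
Proof. by rewrite /dot mulr_sumr; apply: eq_bigr => i _; rewrite mxE mulrCA. Qed.

Lemma dotNr u v : dot u (- v) = - dot u v.
Proof. by rewrite -scaleN1r dotZr mulN1r. Qed.

Lemma dotBr u v x : dot u (v - x) = dot u v - dot u x.
Proof. by rewrite dotDr dotNr. Qed.

Lemma dotDl u v x : dot (u + v) x = dot u x + dot v x.
Proof. by rewrite dotC dotDr !(dotC x). Qed.

Lemma dotZl u a v : dot (a *: u) v = a * dot u v.
Proof. by rewrite dotC dotZr dotC. Qed.

Lemma dotNl u v : dot (- u) v = - dot u v.
Proof. by rewrite dotC dotNr dotC. Qed.

Definition dotE := (dotDr, dotDl, dotNr, dotNl, dotZr, dotZl).

Lemma dot_ge0 u : 0 <= dot u u.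
Proof. by apply: sumr_ge0 => i _; rewrite -expr2 sqr_ge0. Qed.

Lemma dot_eq0 u : (dot u u == 0) = (u == 0).
Proof.
apply/eqP/eqP => [|->]; last by rewrite /dot big1 // => i _; rewrite mxE mul0r.
move=> /eqP; rewrite psumr_eq0 => [/allP u0|i _]; last by rewrite -expr2 sqr_ge0.
apply/rowP => i; rewrite mxE; apply/eqP; rewrite -sqrf_eq0 expr2.
by have := u0 i (mem_index_enum _).
Qed.

Lemma dot_gt0 u : u != 0 -> 0 < dot u u.
Proof. by move=> u0; rewrite lt_def dot_eq0 u0 dot_ge0. Qed.

Lemma enorm_gt0 u : u != 0 -> 0 < enorm u.
Proof. by move=> u0; rewrite sqrtr_gt0 dot_gt0. Qed.

Lemma enorm1 u : enorm u = 1 -> dot u u = 1.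
Proof. by move=> u1; rewrite -[LHS]sqr_sqrtr ?dot_ge0 // -/(enorm u) u1 expr1n. Qed.

Lemma enorm_normalize u : u != 0 -> enorm ((enorm u)^-1 *: u) = 1.
Proof.
move=> u0; have n0 := enorm_gt0 u0.
rewrite {1}/enorm !dotE -[dot u u]sqr_sqrtr ?dot_ge0 // -/(enorm u).
by rewrite mulrA -expr2 -exprMn mulVf ?expr1n ?sqrtr1 // gt_eqF.
Qed.

(** The squared norms of [u - v] and [u + v] give [dot u v < 1] and
    [- 1 <= dot u v], the latter keeping [acos] on its domain. *)
Lemma angle_gt0 u v : enorm u = 1 -> enorm v = 1 -> u != v -> 0 < angle u v.
Proof.
move=> u1 v1 uv; rewrite /angle u1 v1 mulr1 divr1; apply: acos_gt0.
have := dot_ge0 (u + v).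
have : 0 < dot (u - v) (u - v) by rewrite dot_gt0 // subr_eq0.
rewrite !dotE (dotC v u) (enorm1 u1) (enorm1 v1) => h1 h2.
by apply/andP; split; lra.
Qed.

End Dot.

Section ConvexHull.
Variables (R : realType) (n : nat).
Implicit Types (u v x y p q : 'rV[R]_n) (A B : set 'rV[R]_n) (c : R).

Lemma convex_setP A : convex_set A <->
  forall x y (t : R), A x -> A y -> 0 <= t <= 1 -> A (t *: x + (1 - t) *: y).
Proof.
split=> [cvx x y t Ax Ay /andP[t0 t1]|cvx x y t].
  have := cvx x y (Itv01 t0 t1); rewrite !inE; exact.
by rewrite !inE => Ax Ay; apply: cvx => //; rewrite ge0 le1.
Qed.

Lemma conv_hull_convex A : convex_set (conv_hull A).
Proof.
apply/convex_setP => x y t Ax Ay t01 M [cvxM AM].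
by have /convex_setP := cvxM; apply=> //; [exact: Ax|exact: Ay].
Qed.

Lemma sub_conv_hull A : A `<=` conv_hull A.
Proof. exact: sub_gen_smallest. Qed.

Lemma conv_hull_sub A B : convex_set B -> A `<=` B -> conv_hull A `<=` B.
Proof. exact: smallest_sub. Qed.

Lemma convex_halfspace u c : convex_set [set x | dot u x <= c].
Proof.
apply/convex_setP => x y t /= xc yc /andP[t0 t1]; rewrite !dotE; nra.
Qed.

Lemma convex_hyperplane u c : convex_set [set x | dot u x = c].
Proof. by apply/convex_setP => x y t /= xc yc _; rewrite !dotE xc yc; ring. Qed.

(** The set of points that are either strictly below the supporting hyperplane
    or in the hull of the generators lying on it is convex: a proper convex
    combination with a point strictly below is strictly below.  It contains
    all generators, hence the whole hull. *)
Lemma support_set_conv_hull A u x0 : support_set (conv_hull A) u x0 ->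
  support_set (conv_hull A) u = conv_hull [set p | A p /\ dot u p = dot u x0].
Proof.
set T := [set p | _]; move=> [Ax0 maxx0].
have hT : conv_hull T `<=` [set x | dot u x = dot u x0].
  by apply: conv_hull_sub; [exact: convex_hyperplane|move=> p []].
have TA : conv_hull T `<=` conv_hull A.
  apply: conv_hull_sub; first exact: conv_hull_convex.
  by move=> p [Ap _]; exact: sub_conv_hull.
apply/seteqP; split=> [x [Ax maxx]|x Tx]; last first.
  by split=> [|y Ay]; [exact: TA|rewrite (hT x Tx) maxx0].
have : ([set y | dot u y < dot u x0] `|` conv_hull T) x.
  apply: (conv_hull_sub _ _ Ax).
  - apply/convex_setP => y z t yB zB /andP[t0 t1].
    have [->|tn0] := eqVneq t 0; first by rewrite scale0r add0r subr0 scale1r.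
    have [->|tn1] := eqVneq t 1; first by rewrite subrr scale0r addr0 scale1r.
    have tp : 0 < t by rewrite lt_def tn0.
    have tl : t < 1 by rewrite lt_def eq_sym tn1.
    case: yB zB => [/= yl|yT] [/= zl|zT].
    + by left; rewrite /= !dotE; nra.
    + by left; rewrite /= !dotE (hT z zT); nra.
    + by left; rewrite /= !dotE (hT y yT); nra.
    + right; have /convex_setP := @conv_hull_convex T.
      by apply=> //; rewrite t0 t1.
  - move=> p Ap; have := maxx0 p (sub_conv_hull Ap).
    rewrite le_eqVlt => /predU1P[pE|pl]; last by left.
    by right; apply: sub_conv_hull.
case=> //= xl; have := maxx x0 Ax0; lra.
Qed.

(** By [support_set_conv_hull] a face is determined by a subset of the
    generators, encoded here by a bit mask. *)
Lemma finite_faces k (Q : set 'rV[R]_n) : convex_polytope Q ->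
  finite_set (faces k Q).
Proof.
move=> [s ->].
pose h (m : (size s).-tuple bool) := conv_hull [set` mask m s].
apply: (@sub_finite_set _ _ (range h)); last first.
  by apply: finite_image; exact: finite_finset.
move=> F [[x0 [U [Fx0 _ _ _]]] [u _ FE]].
rewrite {}FE in Fx0 *; rewrite (support_set_conv_hull Fx0).
pose a p := dot u p == dot u x0.
exists (map_tuple a (in_tuple s)) => //.
rewrite /h /= -filter_mask; congr conv_hull.
apply/seteqP; split=> p /=; rewrite mem_filter; first by move=> /andP[/eqP].
by move=> [ps pE]; rewrite /a pE eqxx.
Qed.

Lemma seq_argmax (T : eqType) (f : T -> R) (s : seq T) : s != [::] ->
  exists2 p : T, p \in s & forall q : T, q \in s -> f q <= f p.
Proof.
elim: s => // a [_|b s /(_ isT) [p ps pmax]] _.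
  by exists a; rewrite ?mem_head // => q; rewrite inE => /eqP->.
have [ap|pa] := leP (f a) (f p).
  exists p => [|q]; first by rewrite inE ps orbT.
  by rewrite inE => /predU1P[->//|]; exact: pmax.
exists a => [|q]; first exact: mem_head.
by rewrite inE => /predU1P[->//|/pmax qp]; exact: le_trans qp (ltW pa).
Qed.

Lemma convex_segment u v : convex_set (segment u v).
Proof.
apply/convex_setP => _ _ t [a /andP[a0 a1] ->] [b /andP[b0 b1] ->] /andP[t0 t1].
exists (t * a + (1 - t) * b); first by apply/andP; split; nra.
rewrite !scalerDr !scalerA addrACA -!scalerDl; congr (_ *: _ + _ *: _); ring.
Qed.

Lemma segment_subset A u v : convex_set A -> A u -> A v -> segment u v `<=` A.
Proof.
move=> /convex_setP cvx Au Av _ [t /andP[t0 t1] ->].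
by rewrite addrC; apply: cvx => //; rewrite t0 t1.
Qed.

(** The ends of the segment are the generators that minimize and maximize the
    coordinate along [d]. *)
Lemma conv_hull_collinear (T : set 'rV[R]_n) x0 d :
  (exists s : seq 'rV[R]_n, T = [set` s]) -> T !=set0 -> d != 0 ->
  (forall p, T p -> p - x0 \in <[d]>%VS) ->
  exists u v, conv_hull T = segment u v.
Proof.
move=> [s ->] [p0 /= p0s] d0 col.
have s0 : s != [::] by case: (s) p0s.
have [q qs qmax] := seq_argmax (dot d) s0.
have [p ps pmin] := seq_argmax (fun x => - dot d x) s0.
exists p, q; apply/seteqP; split; last first.
  by apply: segment_subset; [exact: conv_hull_convex|apply: sub_conv_hull..].
apply: conv_hull_sub; first exact: convex_segment.
move=> r /= rs.
have dd := dot_gt0 d0.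
have coord x : x \in s -> exists c, x = x0 + c *: d.
  by move=> /col /vlineP[c xE]; exists c; rewrite -xE addrC subrK.
have [a pE] := coord p ps; have [b qE] := coord q qs; have [c rE] := coord r rs.
have := qmax r rs; have := pmin r rs.
rewrite pE qE rE !dotE lerN2 !lerD2l !ler_pM2r // => ac cb.
have [ab|ab] := eqVneq a b.
  exists 0; first by rewrite lexx ler01.
  have -> : c = a by apply: le_anti; rewrite ac ab cb.
  by rewrite subr0 scale1r scale0r addr0.
have ba : 0 < b - a by rewrite subr_gt0 lt_neqAle ab (le_trans ac cb).
exists ((c - a) / (b - a)).
  rewrite divr_ge0 ?(ltW ba) ?subr_ge0 //= ler_pdivrMr // mul1r.
  by rewrite lerD2r.
rewrite !scalerDr !scalerA addrACA -!scalerDl.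
congr (_ + _ *: _); first by rewrite subrK scale1r.
by field; rewrite gt_eqF.
Qed.

End ConvexHull.

(** * Dimension of faces and length of edges *)

Section Dimension.
Variables (R : realType) (n : nat).
Implicit Types (A Q E : set 'rV[R]_n) (x d u : 'rV[R]_n).

(** The direction space does not depend on the base point, because
    [z - y = (z - x) - (y - x)]. *)
Lemma has_dim_inj k j A : has_dim k A -> has_dim j A -> k = j.
Proof.
suff le a b : has_dim a A -> has_dim b A -> (b <= a)%N.
  by move=> hk hj; apply/eqP; rewrite eqn_leq !le.
move=> [x [U [_ AU _ <-]]] [y [V [Ay _ minV <-]]].
apply: dimvS; apply: minV => z Az.
by have := rpredB (AU z Az) (AU y Ay); rewrite opprB addrA subrK.
Qed.

Lemma has_dim1_line A : has_dim 1 A ->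
  exists x0 d, [/\ d != 0, A x0, A (x0 + d)
                 & forall x, A x -> x - x0 \in <[d]>%VS].
Proof.
move=> [x0 [U [Ax0 AU minU dimU]]].
have [x [Ax xx0]] : exists x, A x /\ x != x0.
  apply/not_existsP => no; suff : (U <= 0)%VS.
    by move=> /dimvS; rewrite dimU dimv0.
  apply: minU => x Ax; rewrite memv0 subr_eq0; apply/negPn/negP => xx0.
  exact: (no x).
have d0 : x - x0 != 0 by rewrite subr_eq0.
exists x0, (x - x0); split=> //; first by rewrite addrC subrK.
suff -> : <[x - x0]>%VS = U by [].
by apply/eqP; rewrite eqEdim -memvE AU // dimU dim_vline d0.
Qed.

(** The value of [vol1] is selected among the lengths of all presentations of
    [E] as a segment; each is positive because [E] has two points. *)
Lemma vol1_gt0 Q E : convex_polytope Q -> faces 1 Q E -> 0 < vol1 E.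
Proof.
move=> [s QE] [/has_dim1_line [x0 [d [d0 Ex0 Ex1 colE]]] [w _ EQ]].
pose T := [set p | p \in s /\ dot w p = dot w x0].
have ET : E = conv_hull T.
  by rewrite EQ QE; apply: support_set_conv_hull; rewrite -QE -EQ.
have [u [v Euv]] : exists u v, conv_hull T = segment u v.
  apply: conv_hull_collinear d0 _.
  - exists [seq p <- s | dot w p == dot w x0]; apply/seteqP; split=> p /=.
      by move=> [ps pE]; rewrite mem_filter pE eqxx.
    by rewrite mem_filter => /andP[/eqP].
  - apply/set0P/eqP => T0.
    have : conv_hull T `<=` set0.
      by apply: conv_hull_sub; [apply/convex_setP|rewrite T0].
    by move=> /(_ x0); apply; rewrite -ET.
  - by move=> p Tp; apply: colE; rewrite ET; exact: sub_conv_hull.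
rewrite /vol1; case: xgetP => [l _ [a [b [Eab ->]]]|/(_ (enorm (v - u)))[]].
  apply: enorm_gt0; rewrite subr_eq0; apply: contraNneq d0 => ba.
  move: Ex0 Ex1; rewrite Eab ba => -[t _ ->] [r _].
  by rewrite -!scalerDl !subrK !scale1r => /eqP; rewrite -subr_eq0 addrAC subrr add0r.
by exists u, v; rewrite ET.
Qed.

Lemma support_setZ Q (a : R) u : 0 < a ->
  support_set Q (a *: u) = support_set Q u.
Proof.
move=> a0; apply/seteqP; split=> x [Qx mx]; split=> // y Qy.
  by have := mx y Qy; rewrite !dotE ler_pM2l.
by rewrite !dotE ler_pM2l // mx.
Qed.

Lemma outer_unit_normal_exists k Q E : faces k Q E ->
  exists u, outer_unit_normal Q E u.
Proof.
move=> [_ [u u0 ->]]; exists ((enorm u)^-1 *: u); split.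
  exact: enorm_normalize.
by rewrite support_setZ // invr_gt0 enorm_gt0.
Qed.

Lemma support_set_eq Q u x y :
  support_set Q u x -> support_set Q u y -> dot u x = dot u y.
Proof. by move=> [Qx mx] [Qy my]; apply: le_anti; rewrite mx // my. Qed.

End Dimension.

(** * Edges of three-dimensional polytopes as intersections of facets *)

Section Space.
Variable R : realType.
Implicit Types (Q E F G : set 'rV[R]_3) (u w d e x y z : 'rV[R]_3).

(** From an interior point one can move a little along the normal [u]. *)
Lemma interior_not_in_hyperplane Q u c : interior Q !=set0 -> u != 0 ->
  exists2 y, Q y & dot u y != c.
Proof.
move=> [x Qx] u0; have [xc|xc] := eqVneq (dot u x) c; last first.
  by exists x => //; exact: interior_subset.
have cont : (fun t : R => x + t *: u) @ (0 : R) --> x + 0 *: u.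
  by apply: cvgD; [exact: cvg_cst|apply: cvgZr_tmp; exact: cvg_id].
have : \forall t \near (0 : R), Q (x + t *: u).
  by apply: cont; rewrite scale0r addr0.
move=> /nbhs_ballP [r /= r0 rQ].
exists (x + (r / 2) *: u).
  by apply: rQ; rewrite /ball /= sub0r normrN gtr0_norm; lra.
rewrite !dotE xc addrC -subr_eq0 addrK mulf_neq0 ?gt_eqF ?dot_gt0 //; lra.
Qed.

(** The vector product; the indices are taken modulo 3. *)
Definition cross w d : 'rV[R]_3 :=
  \row_(i < 3) (w 0 (i + 1) * d 0 (i + 2) - w 0 (i + 2) * d 0 (i + 1)).

(** Together with [w] and [d], the vector product [e] is an orthogonal basis,
    so a vector orthogonal to [w] and [e] is a multiple of [d]. *)
Lemma orthogonal_frame w d : w != 0 -> d != 0 -> dot w d = 0 ->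
  exists e, [/\ e != 0, dot e w = 0, dot e d = 0
    & forall z, dot w z = 0 -> dot e z = 0 -> z \in <[d]>%VS].
Proof.
move=> w0 d0 wd.
have sum3 (f : 'I_3 -> R) : \sum_i f i = f 0 + f 1 + f 2.
  rewrite !big_ord_recl big_ord0 addr0 addrA.
  by congr (_ + f _ + f _); apply: val_inj.
have i01 : 0 + 1 = 1 :> 'I_3 by apply: val_inj.
have i02 : 0 + 2 = 2 :> 'I_3 by apply: val_inj.
have i11 : 1 + 1 = 2 :> 'I_3 by apply: val_inj.
have i12 : 1 + 2 = 0 :> 'I_3 by apply: val_inj.
have i21 : 2 + 1 = 0 :> 'I_3 by apply: val_inj.
have i22 : 2 + 2 = 1 :> 'I_3 by apply: val_inj.
have I3 := (i01, i02, i11, i12, i21, i22).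
pose e := cross w d.
have ee : dot e e = dot w w * dot d d - dot w d ^+ 2.
  by rewrite /dot !sum3 !mxE !I3; ring.
have e0 : 0 < dot e e by rewrite ee wd expr0n subr0 mulr_gt0 ?dot_gt0.
exists e; split; first by rewrite -dot_eq0 gt_eqF.
- by rewrite /dot !sum3 !mxE !I3; ring.
- by rewrite /dot !sum3 !mxE !I3; ring.
move=> z wz ez.
(* The expansion of [z] in the basis [e], [w], [d], multiplied by a Gram
   determinant so as to become a polynomial identity in the coordinates. *)
have gram : dot e e *: z = dot e z *: e
    + (dot w z * dot d d - dot d z * dot w d) *: w
    + (dot d z * dot w w - dot w z * dot w d) *: d.
  have expand i : i = 0 \/ i = 1 \/ i = 2 :> 'I_3.
    case: i => [[|[|[|//]]] ?]; [left|right; left|right; right];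
    exact: val_inj.
  apply/rowP => i; rewrite !mxE /dot !sum3 !mxE.
  by case: (expand i) => [|[]] ->; rewrite !I3; ring.
move: gram; rewrite wz ez wd !mul0r !mulr0 !subr0 !scale0r !add0r => zE.
have -> : z = (dot e e)^-1 *: (dot e e *: z).
  by rewrite scalerA mulVf ?scale1r // gt_eqF.
by rewrite zE scalerA; apply/vlineP; eexists.
Qed.

(** Here [w] is a normal of the edge, [d] its direction, and [e] a third vector
    orthogonal to both.  Tilting the normal from [e] towards [w], the plane with
    normal [e + t *: w] through the edge supports [Q] as soon as [t] is at least
    the slope [dot e (p - x0) / dot w (x0 - p)] of every generator [p] off the
    edge.  For the largest slope, the plane contains the edge and one more
    generator, hence cuts out a facet. *)
Lemma rotate_to_facet (s : seq 'rV[R]_3) w d e x0 :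
  let Q := conv_hull [set` s] in
  interior Q !=set0 -> w != 0 -> d != 0 ->
  support_set Q w x0 -> support_set Q w (x0 + d) ->
  (forall x, support_set Q w x -> x - x0 \in <[d]>%VS) ->
  dot e d = 0 ->
  (forall z, dot w z = 0 -> dot e z = 0 -> z \in <[d]>%VS) ->
  exists t, has_dim 2 (support_set Q (e + t *: w)) /\
    support_set Q (e + t *: w) x0.
Proof.
move=> Q intQ w0 d0 Ex0 Ex1 colE ed line.
have wd : dot w d = 0.
  by have := support_set_eq Ex0 Ex1; rewrite !dotE; lra.
pose below := [seq p <- s | dot w p < dot w x0].
(* Otherwise all generators would lie in the plane with normal [w], which
   cannot contain [Q]. *)
have below0 : below != [::].
  apply/eqP => b0.
  have [y Qy /eqP] := interior_not_in_hyperplane (dot w x0) intQ w0; apply.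
  apply: (conv_hull_sub (@convex_hyperplane _ _ w (dot w x0)) _ Qy) => p /= ps.
  apply: le_anti; rewrite (Ex0.2 p (sub_conv_hull ps)) /= leNgt.
  by apply/negP => plt; have : p \in below by [rewrite mem_filter plt]; rewrite b0.
pose slope p := dot e (p - x0) / dot w (x0 - p).
have [p pb pmax] := seq_argmax slope below0.
pose t := slope p; pose u := e + t *: w.
have ps : p \in s by move: pb; rewrite mem_filter => /andP[].
have wp : 0 < dot w (x0 - p).
  by move: pb; rewrite mem_filter dotBr subr_gt0 => /andP[].
have ep : dot e (p - x0) = t * dot w (x0 - p) by rewrite /t /slope divfK ?gt_eqF.
have ux0 : support_set Q u x0.
  split; first exact: Ex0.1.
  move=> y Qy; apply: (conv_hull_sub (@convex_halfspace _ _ u (dot u x0)) _ Qy).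
  move=> q /= qs; rewrite -subr_ge0 -dotBr.
  have [qb|qb] := boolP (q \in below).
    have wq : 0 < dot w (x0 - q).
      by move: qb; rewrite mem_filter dotBr subr_gt0 => /andP[].
    have := pmax q qb; rewrite -/t /slope ler_pdivrMr // /u.
    rewrite !dotE; lra.
  (* A generator that is not below the supporting plane is on the edge, where
     the functional [dot u] is constant. *)
  have Eq : support_set Q w q.
    move: qb; rewrite mem_filter qs andbT -leNgt => qge.
    split=> [|y' Qy']; first exact: sub_conv_hull.
    by rewrite (le_trans _ qge) // Ex0.2.
  have /vlineP[a aE] := colE q Eq.
  rewrite -[x0 - q]opprB aE /u !dotE ed wd; lra.
have up : support_set Q u p.
  split; first exact: sub_conv_hull.
  move=> y Qy; rewrite (le_trans (ux0.2 y Qy)) //.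
  by move: ep; rewrite /u !dotE; lra.
have ud : support_set Q u (x0 + d).
  split=> [|y Qy]; first exact: Ex1.1.
  by rewrite (le_trans (ux0.2 y Qy)) // /u !dotE ed wd; lra.
exists t; split=> //.
pose q := p - x0.
have wq : dot w q != 0 by rewrite /q -opprB dotNr oppr_eq0 gt_eqF.
(* The plane of the facet is spanned by the edge and the generator [p]. *)
exists x0, (<[d]> + <[q]>)%VS; split=> //.
- move=> x Fx; pose y := x - x0; pose c := dot w y / dot w q.
  have uy : dot u y = 0 by rewrite dotBr (support_set_eq Fx ux0) subrr.
  have uq : dot u q = 0 by rewrite dotBr (support_set_eq up ux0) subrr.
  have cE : c * dot w q = dot w y by rewrite /c divfK.
  rewrite -[x - x0](subrK (c *: q)); apply: memv_add; last by apply/vlineP; exists c.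
  apply: line; first by rewrite dotBr dotZr cE subrr.
  move: uy uq; rewrite /u !(dotDl _ _ y, dotDl _ _ q) !dotZl => uy uq.
  rewrite dotBr dotZr -/y.
  have -> : dot e y = - (t * dot w y) by lra.
  have -> : dot e q = - (t * dot w q) by lra.
  by rewrite -cE; ring.
- move=> W FW; rewrite subv_add -!memvE FW // andbT.
  by have := FW _ ud; rewrite addrAC subrr add0r.
- rewrite dimv_disjoint_sum ?dim_vline ?d0.
    have -> // : q != 0.
    by apply: contraNneq wq => ->; rewrite /dot big1 // => i _; rewrite mxE mulr0.
  apply/eqP; rewrite -subv0; apply/subvP => x /memv_capP[/vlineP[a xa] /vlineP[b xb]].
  have := congr1 (dot w) xa; rewrite {1}xb !dotZr wd mulr0 => /eqP.
  by rewrite mulf_eq0 (negPf wq) orbF xb => /eqP->; rewrite scale0r mem0v.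
Qed.

(** The two facets are obtained by tilting from [e] and from [- e].  Their
    normals [u] and [v] add up to a multiple of [w], so a point of [Q] on both
    facets maximizes [dot w], that is, lies on the edge. *)
Lemma edge_facets Q E : convex_polytope Q -> interior Q !=set0 -> edges Q E ->
  exists F G, [/\ facets Q F, facets Q G & F `&` G = E].
Proof.
move=> [s QE] intQ [/has_dim1_line [x0 [d [d0 Ex0 Ex1 colE]]] [w w0 EQ]].
rewrite {}EQ {E} in Ex0 Ex1 colE *.
have wd : dot w d = 0.
  by have := support_set_eq Ex0 Ex1; rewrite !dotE; lra.
have [e [e0 ew ed line]] := orthogonal_frame w0 d0 wd.
have linen z : dot w z = 0 -> dot (- e) z = 0 -> z \in <[d]>%VS.
  by move=> wz; rewrite dotNl => /eqP; rewrite oppr_eq0 => /eqP; exact: line.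
have edn : dot (- e) d = 0 by rewrite dotNl ed oppr0.
subst Q.
have [t [dimF Fx0]] := rotate_to_facet intQ w0 d0 Ex0 Ex1 colE ed line.
have [r [dimG Gx0]] := rotate_to_facet intQ w0 d0 Ex0 Ex1 colE edn linen.
set Q := conv_hull _ in intQ Ex0 Ex1 colE dimF Fx0 dimG Gx0 *.
pose u := e + t *: w; pose v := - e + r *: w.
have ue : dot e u = dot e e by rewrite /u !dotE ew mulr0 addr0.
have ve : dot e v = - dot e e by rewrite /v !dotE ew mulr0 addr0.
have dot0 z : dot e z != 0 -> z != 0.
  by apply: contraNneq => ->; rewrite /dot big1 // => i _; rewrite mxE mulr0.
have u0 : u != 0 by apply: dot0; rewrite ue dot_eq0.
have v0 : v != 0 by apply: dot0; rewrite ve oppr_eq0 dot_eq0.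
(* If [t + r = 0] then [v = - u], and [Q] would lie in a plane. *)
have rt : t + r != 0.
  apply/eqP => tr0.
  have [y Qy /eqP] := interior_not_in_hyperplane (dot u x0) intQ u0; apply.
  have vE : v = - u by rewrite /v (_ : r = - t) ?scaleNr ?opprD //; lra.
  have := Fx0.2 y Qy; have := Gx0.2 y Qy; rewrite -/u -/v vE !dotNl lerN2.
  by move=> h1 h2; apply: le_anti; rewrite h1 h2.
exists (support_set Q u), (support_set Q v); split.
- by split=> //; exists u.
- by split=> //; exists v.
apply/seteqP; split=> x.
  move=> [Fx Gx]; have := support_set_eq Fx Fx0; have := support_set_eq Gx Gx0.
  rewrite /v /u !dotE => h1 h2.
  have /eqP : (t + r) * (dot w x - dot w x0) = 0 by lra.
  rewrite mulf_eq0 (negPf rt) /= subr_eq0 => /eqP wx.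
  by split=> [|y Qy]; [exact: Fx.1|rewrite wx; exact: Ex0.2].
move=> Ex; have /vlineP[a aE] := colE x Ex.
have -> : x = x0 + a *: d by rewrite -aE addrC subrK.
have Qx : Q (x0 + a *: d) by rewrite -aE addrC subrK; exact: Ex.1.
split; split=> // y Qy.
  by rewrite (le_trans (Fx0.2 y Qy)) // !dotE ed wd; lra.
by rewrite (le_trans (Gx0.2 y Qy)) // !dotE ed wd; lra.
Qed.

Lemma external_angle_gt0 Q E : convex_polytope Q -> interior Q !=set0 ->
  edges Q E -> 0 < external_angle Q E.
Proof.
move=> polyQ intQ edgeE; rewrite /external_angle; case: xgetP.
  move=> _ _ [F [G [u [v [[facF _] FG [u1 FE] [v1 GE] ->]]]]].
  apply: angle_gt0 => //; apply/eqP => uv.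
  have EF : E = F by rewrite -FG GE -uv -FE setIid.
  by move: edgeE; rewrite EF => -[dimE _]; have := has_dim_inj dimE facF.1.
have [F [G [facF facG FG]]] := edge_facets polyQ intQ edgeE.
have [u uF] := outer_unit_normal_exists facF.
have [v vG] := outer_unit_normal_exists facG.
by move=> /(_ (angle u v)) []; exists F, G, u, v.
Qed.

End Space.

(** * Comparison of the edge curvature with the mean external angle *)

Section EdgeCurvature.
Variables (R : realType) (Q : set 'rV[R]_3).
Implicit Types f : R -> R.

Lemma affine_onN (D : set R) f : affine_on D (fun t => - f t) <-> affine_on D f.
Proof.
split=> -[a [b fab]]; exists (- a), (- b) => t Dt.
  by rewrite -[f t]opprK fab //; ring.
by rewrite fab //; ring.
Qed.

Lemma edge_curvatureN f : edge_curvature (fun t => - f t) Q = - edge_curvature f Q.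
Proof.
rewrite /edge_curvature -mulrN; congr (_ * _).
rewrite -[RHS]mulN1r mulr_fsumr; apply: eq_fsbigr => E _; ring.
Qed.

(** The interval of the external angles is then at most a point. *)
Lemma equal_angles_affine f : all_dihedral_angles_equal Q ->
  affine_on (external_angle_range Q) f.
Proof.
move=> eqQ; have [[E0 E0Q]|no] := pselect (exists E, edges Q E); last first.
  by exists 0, 0 => t [E [_ [EQ _ _]]]; case: no; exists E.
have eqE E : edges Q E -> external_angle Q E = external_angle Q E0.
  by move=> /eqQ /(_ E0Q) /addrI /oppr_inj.
exists 0, (f (external_angle Q E0)) => t [E [F [/eqE -> /eqE -> tE]]].
by rewrite mul0r add0r; congr f; apply: le_anti; rewrite andbC.
Qed.

Lemma edge_jensen f : convex_polytope Q -> interior Q !=set0 ->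
  convex_on_pos f ->
  2^-1 * f (mean_external_angle Q) * total_edge_length Q <= edge_curvature f Q
  /\ (edge_curvature f Q
        = 2^-1 * f (mean_external_angle Q) * total_edge_length Q
      <-> affine_on (external_angle_range Q) f
          \/ all_dihedral_angles_equal Q).
Proof.
move=> polyQ intQ cvx.
have fin : finite_set (edges Q) := finite_faces 1 polyQ.
pose s := finmap.enum_fset (fset_set (edges Q)).
have sE E : (E \in s) = (E \in edges Q) by rewrite -in_fset_set.
have affineE : affine_on (external_angle_range Q) f
    \/ all_dihedral_angles_equal Q <-> affine_on (external_angle_range Q) f.
  by split=> [[//|/equal_angles_affine]|]; [apply|left].
have fsE (h : set 'rV[R]_3 -> R) : \sum_(E \in edges Q) h E = \sum_(E <- s) h E.
  by rewrite fsbig_finite.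
rewrite affineE /edge_curvature /mean_external_angle /total_edge_length.
(* Without edges, both sides vanish and every function is affine on the
   empty range. *)
have [s0|s0] := eqVneq s [::].
  rewrite !fsE s0 !big_nil !mulr0; split=> //; split=> // _.
  exists 0, 0 => t [E [_ [EQ _ _]]].
  by have : E \in s by [rewrite sE inE]; rewrite s0.
have w0 E : E \in s -> 0 < vol1 E.
  by rewrite sE inE => EQ; exact: vol1_gt0 polyQ EQ.
have x0 E : E \in s -> 0 < external_angle Q E.
  by rewrite sE inE; exact: external_angle_gt0.
have [le eq] := jensen w0 x0 s0 cvx.
have DE : external_angle_range Q = [set t | exists E F,
    [/\ E \in s, F \in s & external_angle Q E <= t <= external_angle Q F]].
  by apply/seteqP; split=> t [E [F [EQ FQ tEF]]]; exists E, F;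
    split=> //; move: EQ FQ; rewrite !sE !inE.
rewrite DE -eq !fsE -mulrA; split; first by rewrite ler_pM2l ?invr_gt0.
by split=> [/mulfI -> //|-> //]; rewrite invr_eq0.
Qed.

End EdgeCurvature.

Theorem theorem6p1 (R : realType) (Q : set 'rV[R]_3)
    (Qpolytope : convex_polytope Q) (Qinterior : interior Q !=set0) :
  (forall phi : R -> R, positive_on_pos phi -> concave_on_pos phi ->
     edge_curvature phi Q
       <= 2^-1 * phi (mean_external_angle Q) * total_edge_length Q
     /\ (edge_curvature phi Q
           = 2^-1 * phi (mean_external_angle Q) * total_edge_length Q
         <-> affine_on (external_angle_range Q) phi
             \/ all_dihedral_angles_equal Q))
  /\
  (forall psi : R -> R, positive_on_pos psi -> convex_on_pos psi ->
     2^-1 * psi (mean_external_angle Q) * total_edge_length Q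
       <= edge_curvature psi Q
     /\ (edge_curvature psi Q
           = 2^-1 * psi (mean_external_angle Q) * total_edge_length Q
         <-> affine_on (external_angle_range Q) psi
             \/ all_dihedral_angles_equal Q)).
Proof.
split=> [phi _ cvx|psi _ cvx]; last exact: edge_jensen.
have [le eq] := edge_jensen Qpolytope Qinterior cvx.
move: le eq; rewrite edge_curvatureN mulrN mulNr lerN2 => le eq; split=> //.
split=> [phiE|].
  have [|/affine_onN|] := (iffLR eq) _; [by rewrite phiE|by left|by right].
move=> phiE; apply: oppr_inj; apply/eq.
by case: phiE => [/affine_onN|]; [left|right].
Qed.
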